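(* Let $d\in\{1,2,\dots\}$, let $X$ be a splittable stationary random field on $\mathbb{R}^d$, let $\varphi:\mathbb{R}^d\to\mathbb{R}$ be continuous and compactly supported, and let $\sigma_X\in[0,\infty)$ be the number defined in the context. If $\|\varphi\|\sigma_X\ne0$, where $\|\varphi\|^2=\int_{\mathbb{R}^d}\varphi^2(t)\,dt$, then the distribution of $$r^{-d/2}\int_{\mathbb{R}^d}\varphi\Big(\frac1rt\Big)X_t\,dt$$ converges, as $r\to\infty$, to the normal distribution $N(0,\|\varphi\|^2\sigma_X^2)$ (mean $0$, variance $\|\varphi\|^2\sigma_X^2$).
   Context: Random fields. A locally finite signed Borel measure (LFSBM) on $\mathbb{R}^d$ is a real-valued set function on the bounded Borel subsets of $\mathbb{R}^d$ whose restriction to the Borel subsets of any bounded Borel set is a (countably additive, finite) signed measure. The set of LFSBMs carries the $\sigma$-field generated by the maps $\mu\mapsto\int f\,d\mu$, $f$ continuous with compact support. A random field $X$ on $\mathbb{R}^d$ (and on a probability space $\Omega$) is a measurable map from $\Omega$ to the space of LFSBMs on $\mathbb{R}^d$; it is denoted as if it had a density: $B\mapsto\int_B X_t\,dt$. The (random, positive, locally finite) variation measure is denoted $B\mapsto\int_B|X_t|\,dt$; it extends to all Borel sets with values in $[0,\infty]$. For locally bounded Borel $\varphi$, $\varphi X=(\varphi(t)X_t)_t$ is the measure with density $\varphi$ relative to $X$. For a coordinate permutation composed with a shift, $\alpha:\mathbb{R}^d\to\mathbb{R}^d$, the field $(X_{\alpha(t)})_t$ is defined by $\int_B X_{\alpha(t)}\,dt=\int_{\alpha(B)}X_t\,dt$.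 $X$ is stationary if $(X_{t+s})_t$ has the same distribution as $X$ for every $s\in\mathbb{R}^d$. Identically distributed fields may live on different probability spaces. Split and leak. A split of a random field $X$ on $\mathbb{R}^d$ is a triple $(X^0,X^-,X^+)$ of random fields on $\mathbb{R}^d$, all defined on one probability space $\tilde\Omega$ (possibly different from that of $X$), such that $X^-,X^+$ are independent and each of $X^0,X^-,X^+$ is distributed like $X$. Its leak is the random field $Y$ on $\tilde\Omega$ with $Y_t=X^-_t-X^0_t$ when $t_1<0$ and $Y_t=X^+_t-X^0_t$ when $t_1\ge0$ (equality of measures on the two half-spaces). A random field $Y$ on any probability space is a leak for $X$ if it is distributed like the leak of some split of $X$. Splittability. Let $k\in\{1,\dots,d\}$. A random field $X$ on $\mathbb{R}^d$ is $(1,k)$-splittable (recursively in $k$) if: (a) for every $s\in\mathbb{R}^k$, $\mathbb{E}\exp\int_{([0,1)^k+s)\times\mathbb{R}^{d-k}}|X_t|\,dt\le2$; (b) $\mathbb{E}\int_A X_t\,dt=0$ for every bounded Borel $A\subset\mathbb{R}^d$; (c) for every $i\in\{1,\dots,k\}$ and $r\in\mathbb{R}$ the random field $\tilde X_{t_1,\dots,t_d}=X_{t_2,\dots,t_i,t_1+r,t_{i+1},\dots,t_d}$ has a leak $\tilde Y$ such that the random field $Y_{t_1,\dots,t_d}=\tilde Y_{t_k,t_1,\dots,t_{k-1},t_{k+1},\dots,t_d}$ is $(1,k-1)$-splittable if $k>1$, and satisfies $\mathbb{E}\exp\int_{\mathbb{R}^d}|Y_t|\,dt\le2$ if $k=1$.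 For $C\in(0,\infty)$, $X$ is $(C,k)$-splittable if $\frac1CX$ is $(1,k)$-splittable; $X$ is $C$-splittable if it is $(C,d)$-splittable; $X$ is splittable if it is $C$-splittable for some $C\in(0,\infty)$. The number $\sigma_X$. For a splittable stationary $X$, $\sigma_X$ is the unique number in $[0,\infty)$ such that for every continuous compactly supported $\varphi:\mathbb{R}^d\to\mathbb{R}$, $\frac1{r^d\lambda^2}\log\mathbb{E}\exp\big(\lambda\int_{\mathbb{R}^d}\varphi(\frac1rt)X_t\,dt\big)\to\frac12\|\varphi\|^2\sigma_X^2$ as $r\to\infty$, $\lambda\to0$ ($\lambda\in\mathbb{R}\setminus\{0\}$), $\lambda\log^d r\to0$; that is, for every $\eta>0$ there are $R,\delta>0$ such that the expression is within $\eta$ of the limit whenever $r>R$, $0<|\lambda|<\delta$, $|\lambda|(\log r)^d<\delta$. Its existence is another theorem of the same paper and is part of the setting here. *)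

(* Defs.v *)
From HB Require Import structures.
From mathcomp Require Import all_boot all_order all_algebra all_fingroup.
From mathcomp Require Import all_classical all_reals all_analysis.
From mathcomp Require Import measurable_realfun.

Set Implicit Arguments.
Unset Strict Implicit.
Unset Printing Implicit Defensive.

Import Order.TTheory GRing.Theory Num.Theory.
Import numFieldNormedType.Exports.

Local Open Scope classical_set_scope.
Local Open Scope ring_scope.

Section borel.
Variables (R : realType) (n : nat).
Local Notation G := (@open 'rV[R]_n).

(* The measurable structure put on 'rV[R]_n is the Borel sigma-algebra of its
   (max-norm) topology. *)
HB.instance Definition _ := @isMeasurable.Build (sigma_display G)
  'rV[R]_n <<s G >> (@sigma_algebra0 _ setT G) (@sigma_algebraC _ G)
  (@sigma_algebra_bigcup _ setT G).

Lemma rV_open_measurable (A : set 'rV[R]_n) : open A -> measurable A.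
Proof. exact: sub_sigma_algebra. Qed.

Lemma rV_coord_measurable (i : 'I_n) :
  measurable_fun setT (fun t : 'rV[R]_n => t ord0 i).
Proof.
apply: (measurability _ (RGenOpens.measurableE R)).
move=> _ [_ [a [b ->] <-]]; rewrite setTI; apply: rV_open_measurable.
by apply: open_comp; [move=> x _; exact: coord_continuous|exact: interval_open].
Qed.

Lemma rV_ball_rat (t : 'rV[R]_n) (e : R) : 0 < e ->
  exists2 q : 'rV[rat]_n,
    ball (map_mx ratr q : 'rV[R]_n) e t & ball t e (map_mx ratr q : 'rV[R]_n).
Proof.
move=> e0.
have /choice[q qP] (i : 'I_n) : exists q : rat, `|ratr q - t ord0 i| < e.
  have [|q] := @rat_in_itvoo R (t ord0 i - e) (t ord0 i + e).
    by rewrite ltrBlDr -addrA ltrDl addr_gt0.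
  rewrite in_itv/= => /andP[q1 q2]; exists q.
  by rewrite ltr_norml ltrBlDl q2 andbT ltrBrDr addrC.
suff H : ball t e (map_mx ratr (\row_i q i) : 'rV[R]_n).
  by exists (\row_i q i) => //; exact: ball_sym.
split=> // i j; rewrite !mxE (ord1 i) -ball_normE /=.
by rewrite distrC; exact: qP.
Qed.

Lemma rV_measurable_fun d (T : measurableType d) (f : T -> 'rV[R]_n) :
  (forall i, measurable_fun setT (fun x => f x ord0 i)) -> measurable_fun setT f.
Proof.
move=> mf; apply: (@measurability _ _ _ _ _ _ G) => // _ [U oU <-].
pose c (p : 'rV[rat]_n * nat) : 'rV[R]_n := map_mx ratr p.1.
pose B (p : 'rV[rat]_n * nat) := ball (c p) (p.2.+1%:R^-1 : R).
pose F p := if `[< B p `<=` U >] then f @^-1` B p else set0.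
have -> : [set: T] `&` f @^-1` U = \bigcup_p F p.
  rewrite setTI; apply/seteqP; split=> [x Ux|x [p _]]; last first.
    by rewrite /F; case: asboolP => // + Bx; exact.
  move: oU; rewrite openE => /(_ _ Ux) /nbhs_ballP[e /= e0 eU].
  have [k ke] : exists k : nat, k.+1%:R^-1 < e / 2.
    exists (Num.truncn (e / 2)^-1).
    rewrite invf_plt ?posrE ?divr_gt0//.
    exact: truncnS_gt.
  have k0 : 0 < k.+1%:R^-1 :> R by rewrite invr_gt0.
  have [q q1 q2] := rV_ball_rat (f x) k0.
  exists (q, k) => //; rewrite /F; case: asboolP => // -[].
  move=> y By; apply: eU; rewrite (splitr e).
  by apply: (ball_triangle (le_ball (ltW ke) q2)); exact: le_ball (ltW ke) _ By.
apply: countable_bigcupT_measurable => // p.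
rewrite /F; case: asboolP => // _.
have -> : f @^-1` B p = \bigcap_(i : 'I_n)
    ([set x | ball (c p ord0 i) p.2.+1%:R^-1 (f x ord0 i)]).
  apply/seteqP; split => [x [_ Bx] i _|x Bx]; first exact: Bx.
  by split=> [|i j]; [rewrite invr_gt0|rewrite (ord1 i); exact: Bx].
apply: fin_bigcap_measurable => // i _.
rewrite -[X in measurable X]setTI; apply: mf => //.
by apply: open_measurable; exact: ball_open.
Qed.

End borel.

Lemma rV_continuous_measurable (R : realType) m n (f : 'rV[R]_m -> 'rV[R]_n) :
  continuous f -> measurable_fun setT f.
Proof.
move=> cf; apply: (@measurability _ _ _ _ _ _ (@open 'rV[R]_n)) => //.
move=> _ [B oB <-]; rewrite setTI; apply: rV_open_measurable.
by move/continuousP: cf; exact.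
Qed.

Section lebesgue_rV.
Variable R : realType.
Local Open Scope ereal_scope.

(* R^n.+1 is identified with R * R^n through the first coordinate, and Lebesgue
   measure is the iterated product of the one-dimensional ones; lebesgue_rV_box
   below gives its value on boxes. *)
Definition rV_cons n (p : R * 'rV[R]_n) : 'rV[R]_n.+1 :=
  row_mx (p.1%:M : 'rV_1) p.2.

Definition rV_uncons n (t : 'rV[R]_n.+1) : R * 'rV[R]_n :=
  (t ord0 ord0, @rsubmx R 1 1 n t).

Lemma measurable_rV_cons n : measurable_fun setT (@rV_cons n).
Proof.
apply: rV_measurable_fun => i.
case: (@split_ordP 1 n i) => [j ->|j ->].
  under eq_fun do rewrite /rV_cons (@row_mxEl _ 1 1 n) mxE (ord1 j) eqxx mulr1n.
  exact: measurable_fst.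
under eq_fun do rewrite /rV_cons (@row_mxEr _ 1 1 n).
exact: (measurableT_comp (rV_coord_measurable j) measurable_snd).
Qed.

Lemma measurable_rV_uncons n : measurable_fun setT (@rV_uncons n).
Proof.
apply/measurable_fun_pairP; split; first exact: rV_coord_measurable.
apply: rV_continuous_measurable; exact: (@continuous_rsubmx R 1 1 n).
Qed.

Lemma rV_consK n : cancel (@rV_cons n) (@rV_uncons n).
Proof.
case=> x t; rewrite /rV_cons /rV_uncons row_mxKr; congr pair.
have -> : ord0 = @lshift 1 n ord0 by exact/val_inj.
by rewrite (@row_mxEl _ 1 1 n) mxE eqxx.
Qed.

Section cons_measure.
Variables (n : nat) (m : {sigma_finite_measure set 'rV[R]_n -> \bar R}).

Definition lebesgue_rV_cons : set 'rV[R]_n.+1 -> \bar R :=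
  pushforward (lebesgue_measure \x m) (@rV_cons n).

Let mcons_preimage A : measurable A -> measurable (@rV_cons n @^-1` A).
Proof.
by move=> mA; rewrite -[X in measurable X]setTI; exact: measurable_rV_cons.
Qed.

Let cons0 : lebesgue_rV_cons set0 = 0.
Proof. by rewrite /lebesgue_rV_cons /pushforward preimage_set0 measure0. Qed.

Let cons_ge0 A : 0 <= lebesgue_rV_cons A.
Proof. by rewrite /lebesgue_rV_cons /pushforward measure_ge0. Qed.

Let cons_sigma_additive : semi_sigma_additive lebesgue_rV_cons.
Proof.
move=> F mF tF mUF; rewrite /lebesgue_rV_cons /pushforward preimage_bigcup.
apply: measure_semi_sigma_additive => [i||].
- exact: mcons_preimage.
- apply/trivIsetP => i j _ _ ij; rewrite -preimage_setI.
  by move/trivIsetP : tF => /(_ _ _ _ _ ij) ->//; rewrite preimage_set0.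
- by rewrite -preimage_bigcup; exact: mcons_preimage.
Qed.

HB.instance Definition _ := isMeasure.Build _ _ _ lebesgue_rV_cons
  cons0 cons_ge0 cons_sigma_additive.

Let cons_sigma_finite : sigma_finite setT lebesgue_rV_cons.
Proof.
have /sigma_finiteP[F [FT ndF Foo]] := sigma_finiteT (@lebesgue_measure R).
have /sigma_finiteP[G [GT ndG Goo]] := sigma_finiteT m.
exists (fun k => @rV_uncons n @^-1` (F k `*` G k)).
  rewrite -preimage_bigcup; apply/esym; rewrite -subTset => t _ /=.
  have : (\bigcup_k F k) (rV_uncons t).1 by rewrite -FT.
  have : (\bigcup_k G k) (rV_uncons t).2 by rewrite -GT.
  move=> [k _ Gk] [l _ Fl]; exists (maxn k l) => //; split => /=.
  - by apply: (subsetPset _ _ (ndF _ _ (leq_maxr k l))); exact: Fl.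
  - by apply: (subsetPset _ _ (ndG _ _ (leq_maxl k l))); exact: Gk.
move=> k; have [mF Fk] := Foo k; have [mG Gk] := Goo k; split.
  rewrite -[X in measurable X]setTI; apply: measurable_rV_uncons => //.
  exact: measurableX.
rewrite /lebesgue_rV_cons /pushforward -comp_preimage.
suff -> : @rV_uncons n \o @rV_cons n = id.
  by rewrite preimage_id product_measure1E// lte_mul_pinfty// ge0_fin_numE.
by apply/funext => x /=; rewrite rV_consK.
Qed.

HB.instance Definition _ := Measure_isSigmaFinite.Build _ _ _ lebesgue_rV_cons
  cons_sigma_finite.

End cons_measure.

Fixpoint lebesgue_rV n : {sigma_finite_measure set 'rV[R]_n -> \bar R} :=
  match n with
  | 0%N => dirac (0%R : 'rV[R]_0)
  | n.+1 => lebesgue_rV_cons (lebesgue_rV n)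
  end.

Lemma lebesgue_rV_box n (A : 'I_n -> set R) : (forall i, measurable (A i)) ->
  lebesgue_rV n [set t | forall i, A i (t ord0 i)] =
  \prod_(i < n) lebesgue_measure (A i).
Proof.
elim: n A => [|n IH] A mA.
  by rewrite big_ord0 /= diracE mem_set// => -[].
rewrite big_ord_recl -IH//= /lebesgue_rV_cons /pushforward.
rewrite (_ : _ @^-1` _ =
  A ord0 `*` [set t : 'rV_n | forall i, A (lift ord0 i) (t ord0 i)]).
  rewrite product_measure1E//; first exact: mA.
  rewrite [X in measurable X](_ : _ =
    \bigcap_(i : 'I_n) [set t : 'rV[R]_n | A (lift ord0 i) (t ord0 i)]); last first.
    by apply/seteqP; split=> [t At i _|t At i]; exact: At.
  apply: fin_bigcap_measurable => // i _.
  by rewrite -[X in measurable X]setTI; exact: rV_coord_measurable.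
have E0 : ord0 = @lshift 1 n ord0 by exact/val_inj.
have E1 i : lift ord0 i = @rshift 1 n i by exact/val_inj.
apply/seteqP; split => [[x t]/= H|[x t]/= [H1 H2] i].
  split=> [|i /=].
    by have := H ord0; rewrite /rV_cons/= {2}E0 (@row_mxEl _ 1 1 n) mxE eqxx.
  by have := H (lift ord0 i); rewrite /rV_cons/= {2}E1 (@row_mxEr _ 1 1 n).
rewrite /rV_cons/=; case: (unliftP ord0 i) => [j ->|->].
  by rewrite {2}E1 (@row_mxEr _ 1 1 n); exact: H2.
by rewrite {2}E0 (@row_mxEl _ 1 1 n) mxE eqxx.
Qed.

End lebesgue_rV.

Definition bounded_borel (R : realType) n (B : set 'rV[R]_n) :=
  measurable B /\ bounded_set B.

Section bounded_borel_lemmas.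
Variables (R : realType) (n : nat).
Implicit Types A B : set 'rV[R]_n.

Lemma bounded_borel0 : bounded_borel (set0 : set 'rV[R]_n).
Proof. by split; [exact: measurable0|exists 0; split=> // M _ x]. Qed.

Lemma bounded_borelU A B :
  bounded_borel A -> bounded_borel B -> bounded_borel (A `|` B).
Proof.
move=> [mA bA] [mB bB]; split; first exact: measurableU.
move: bA bB => [M [Mr bM]] [N [Nr bN]].
exists (Num.max M N); split; first exact: num_real.
by move=> K; rewrite gt_max => /andP[MK NK] x [/(bM _ MK)|/(bN _ NK)].
Qed.

Lemma bounded_borelS A B :
  measurable A -> A `<=` B -> bounded_borel B -> bounded_borel A.
Proof.
move=> mA AB [_ [M [Mr bM]]]; split=> //; exists M; split=> // K MK x /AB.
exact: bM.
Qed.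

End bounded_borel_lemmas.

(* Only the values of lf_val on bounded Borel sets are meaningful; the values on
   other sets are arbitrary, and neither the variation, nor the integrals, nor
   the sigma-field defined below depend on them. *)
Record lfsbm (R : realType) (n : nat) := Lfsbm {
  lf_val :> set 'rV[R]_n -> R ;
  lf_charge : forall B, bounded_borel B ->
    exists nu : {charge set 'rV[R]_n -> \bar R},
      forall A, measurable A -> A `<=` B -> nu A = (lf_val A)%:E }.

Section lfsbm_parts.
Variables (R : realType) (n : nat) (mu : lfsbm R n).
Local Open Scope ereal_scope.

(* Positive part of the Jordan decomposition, with values in [0, +oo] on all
   Borel sets. *)
Definition lf_pos (A : set 'rV[R]_n) : \bar R :=
  ereal_sup [set (mu B)%:E | B in [set B | bounded_borel B /\ B `<=` A]].

Let lf0 : mu set0 = 0%R.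
Proof.
have [nu nuE] := lf_charge mu (@bounded_borel0 R n).
by have := nuE set0 measurable0 (@subset_refl _ _); rewrite charge0 => -[].
Qed.

Let lf_posS A B : A `<=` B -> lf_pos A <= lf_pos B.
Proof.
move=> AB; apply: ereal_sup_le => _ [C [bC CA] <-].
by exists C => //; split=> //; exact: subset_trans AB.
Qed.

Let lf_pos_ge0 A : 0 <= lf_pos A.
Proof.
apply: ereal_sup_ubound; exists set0; last by rewrite lf0.
by split=> //; exact: bounded_borel0.
Qed.

Let lf_pos0 : lf_pos set0 = 0.
Proof.
apply/eqP; rewrite eq_le lf_pos_ge0 andbT; apply: ge_ereal_sup => _ [B [_ B0] <-].
by rewrite (_ : B = set0) ?lf0//; apply/seteqP; split.
Qed.

Let lf_pos_superadd A B : A `&` B = set0 ->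
  lf_pos A + lf_pos B <= lf_pos (A `|` B).
Proof.
move=> AB0; have [->|foo] := eqVneq (lf_pos (A `|` B)) +oo; first exact: leey.
have ffin C : C `<=` A `|` B -> lf_pos C \is a fin_num.
  move=> CAB; rewrite ge0_fin_numE//; apply: le_lt_trans (lf_posS CAB) _.
  by rewrite ltey.
rewrite -leeBrDr; last by apply: ffin; exact: subsetUr.
apply: ge_ereal_sup => _ [C [bC CA] <-].
rewrite leeBrDr; last by apply: ffin; exact: subsetUr.
rewrite addeC -leeBrDr//; apply: ge_ereal_sup => _ [D [bD DB] <-].
rewrite leeBrDr//; apply: ereal_sup_ubound; exists (D `|` C).
  split; first exact: bounded_borelU.
  by rewrite setUC; exact: setUSS.
have [nu nuE] := lf_charge mu (bounded_borelU bD bC).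
have [mC mD] := (bC.1, bD.1).
rewrite -nuE//; last exact: measurableU.
rewrite chargeU//; first by rewrite !nuE.
by apply/seteqP; split => // x [Dx Cx]; rewrite -AB0; split; [exact: CA|exact: DB].
Qed.

Let lf_pos_sigma_additive : semi_sigma_additive lf_pos.
Proof.
move=> F mF tF mU.
suff <- : \sum_(0 <= i <oo) lf_pos (F i) = lf_pos (\bigcup_i F i).
  by apply: is_cvg_nneseries => k _ _; exact: lf_pos_ge0.
apply/eqP; rewrite eq_le; apply/andP; split.
  apply: lime_le; first by apply: is_cvg_nneseries => k _ _; exact: lf_pos_ge0.
  apply: nearW => k.
  have H : \sum_(0 <= i < k) lf_pos (F i) <= lf_pos (\big[setU/set0]_(i < k) F i).
    elim: k => [|k IH]; first by rewrite big_nil lf_pos_ge0.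
    rewrite big_nat_recr//= big_ord_recr/=.
    apply: le_trans (lf_pos_superadd _); first exact: leeD2r.
    rewrite -bigcup_mkord; apply/seteqP; split=> // x [[i /= ik Fi] Fk].
    have /= := tF i k I I => /(_ (ex_intro _ x (conj Fi Fk))) E.
    by rewrite E ltnn in ik.
  apply: (le_trans H); apply: lf_posS; exact: bigsetU_bigcup.
apply: ge_ereal_sup => _ [B [bB BU] <-].
have [nu nuE] := lf_charge mu bB.
have mB := bB.1.
have mFB i : measurable (F i `&` B) by exact: measurableI.
have UE : \bigcup_i (F i `&` B) = B by rewrite -setI_bigcupl; exact/setIidr.
have tFB : trivIset setT (fun i => F i `&` B).
  by move=> i j _ _ [x [[Fi _] [Fj _]]]; apply: tF => //; exists x.
have := @charge_semi_sigma_additive _ _ _ nu _ mFB tFB.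
rewrite UE => /(_ mB) cnu; rewrite -nuE// -(cvg_lim _ cnu)//.
apply: lee_lim.
- by apply/cvg_ex; eexists; exact: cnu.
- by apply: is_cvg_nneseries => k _ _; exact: lf_pos_ge0.
apply: nearW => k; apply: lee_sum => i _; rewrite nuE//.
apply: ereal_sup_ubound; exists (F i `&` B) => //; split=> //.
by apply: bounded_borelS bB.
Qed.

HB.instance Definition _ := isMeasure.Build _ _ _ lf_pos
  lf_pos0 lf_pos_ge0 lf_pos_sigma_additive.

End lfsbm_parts.

Section lfsbm_operations.
Variables (R : realType) (n : nat).
Implicit Types mu : lfsbm R n.

Lemma lf_scale_charge (c : R) mu B : bounded_borel B ->
  exists nu : {charge set 'rV[R]_n -> \bar R},
    forall A, measurable A -> A `<=` B -> nu A = (c * mu A)%:E.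
Proof.
move=> /(lf_charge mu)[nu nuE]; exists (cscale c nu) => A mA AB.
by rewrite /= /cscale nuE.
Qed.

Definition lf_scale (c : R) mu : lfsbm R n := Lfsbm (@lf_scale_charge c mu).

Definition lf_neg mu := lf_pos (lf_scale (-1) mu).

HB.instance Definition _ mu := Measure.on (lf_neg mu).

Definition lf_var mu := measure_add (lf_pos mu) (lf_neg mu).

HB.instance Definition _ mu := Measure.on (lf_var mu).

Definition lf_int mu (f : 'rV[R]_n -> R) : R :=
  \int[lf_pos mu]_t f t - \int[lf_neg mu]_t f t.

(* alpha(t)_j = t_(s j) + v_j, and lf_reindex s v mu is B |-> mu (alpha(B)), the
   "density" of which is t |-> mu_(alpha(t)). *)
Definition shift_perm (s : 'S_n) (v t : 'rV[R]_n) : 'rV[R]_n :=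
  \row_j (t ord0 (s j) + v ord0 j).

Let unshift (s : 'S_n) (v t : 'rV[R]_n) : 'rV[R]_n :=
  \row_j (t ord0 ((s^-1)%g j) - v ord0 ((s^-1)%g j)).

Let shiftK s v : cancel (shift_perm s v) (unshift s v).
Proof. by move=> t; apply/rowP => j; rewrite !mxE permKV addrK. Qed.

Let unshiftK s v : cancel (unshift s v) (shift_perm s v).
Proof. by move=> t; apply/rowP => j; rewrite !mxE permK subrK. Qed.

Let image_shift s v A : shift_perm s v @` A = unshift s v @^-1` A.
Proof.
apply/seteqP; split=> [_ [t At <-]|t At] /=; first by rewrite shiftK.
by exists (unshift s v t) => //; rewrite unshiftK.
Qed.

Let measurable_unshift s v : measurable_fun setT (unshift s v).
Proof.
apply: rV_measurable_fun => j; under eq_fun do rewrite mxE.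
by apply: measurable_funB => //; exact: rV_coord_measurable.
Qed.

Let bounded_shift s v B : bounded_borel B -> bounded_borel (shift_perm s v @` B).
Proof.
move=> [mB [M [Mr BM]]]; split.
  by rewrite image_shift -[X in measurable X]setTI; exact: measurable_unshift.
exists (M + 1 + `|v|); split; first exact: num_real.
move=> N MN _ [t Bt <-].
have tM : `|t| <= M + 1 by apply: BM => //; rewrite ltrDl.
have N0 : 0 <= N.
  by apply: le_trans (ltW MN); rewrite addr_ge0// (le_trans _ tM).
rewrite /Num.norm/= mx_normrE; apply/bigmax_leP; split => // -[i j] _ /=.
rewrite mxE; apply: le_trans (ler_normD _ _) _; apply: le_trans _ (ltW MN).
have coord (u : 'rV[R]_n) (k : 'I_n) : `|u ord0 k| <= `|u|.
  rewrite [leRHS]/Num.norm/= mx_normrE.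
  exact: (le_bigmax _ (fun ij => `|u ij.1 ij.2|) (ord0, k)).
by apply: lerD; [apply: le_trans tM; exact: coord|exact: coord].
Qed.

Lemma lf_reindex_charge (s : 'S_n) (v : 'rV[R]_n) mu B : bounded_borel B ->
  exists nu : {charge set 'rV[R]_n -> \bar R},
    forall A, measurable A -> A `<=` B -> nu A = (mu (shift_perm s v @` A))%:E.
Proof.
move=> bB; have [nu nuE] := lf_charge mu (bounded_shift s v bB).
pose nu' : {charge set 'rV[R]_n -> \bar R} :=
  measure_function_pushforward__canonical__charge_Charge nu
    (@measurable_unshift s v).
exists nu' => A mA AB; rewrite /nu' /= /pushforward -nuE ?image_shift//.
  by rewrite -[X in measurable X]setTI; exact: measurable_unshift.
by move=> t /AB.
Qed.

Definition lf_reindex (s : 'S_n) (v : 'rV[R]_n) mu : lfsbm R n :=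
  Lfsbm (@lf_reindex_charge s v mu).

Lemma lf_zero_charge B : bounded_borel B ->
  exists nu : {charge set 'rV[R]_n -> \bar R},
    forall A, measurable A -> A `<=` B -> nu A = 0%:E.
Proof. by exists czero. Qed.

Definition lf_zero : lfsbm R n := Lfsbm lf_zero_charge.

End lfsbm_operations.

Section lfsbm_leak.
Variables (R : realType) (d : nat).
Implicit Types mu : lfsbm R d.+1.

Definition left_half : set 'rV[R]_d.+1 := [set t | t ord0 ord0 < 0].
Definition right_half : set 'rV[R]_d.+1 := [set t | 0 <= t ord0 ord0].

Let mleft : measurable left_half.
Proof.
rewrite (_ : left_half =
    setT `&` (fun t : 'rV[R]_d.+1 => t ord0 ord0) @^-1` `]-oo, 0[%classic).
  exact: rV_coord_measurable.
by rewrite setTI; apply/seteqP; split=> t; rewrite /left_half /= in_itv.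
Qed.

Let mright : measurable right_half.
Proof.
rewrite (_ : right_half = ~` left_half); first exact: measurableC.
by apply/seteqP; split=> t; rewrite /left_half /right_half /= leNgt => /negP.
Qed.

Lemma lf_leak_charge (mu0 mum mup : lfsbm R d.+1) B : bounded_borel B ->
  exists nu : {charge set 'rV[R]_d.+1 -> \bar R},
    forall A, measurable A -> A `<=` B -> nu A =
      ((mum (A `&` left_half) - mu0 (A `&` left_half)) +
       (mup (A `&` right_half) - mu0 (A `&` right_half)))%:E.
Proof.
move=> bB.
have [nu0 E0] := lf_charge mu0 bB.
have [num Em] := lf_charge mum bB.
have [nup Ep] := lf_charge mup bB.
exists (cadd (cadd (crestr num mleft) (copp (crestr nu0 mleft)))
             (cadd (crestr nup mright) (copp (crestr nu0 mright)))) => A mA AB.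
have ml : measurable (A `&` left_half) by exact: measurableI.
have mr : measurable (A `&` right_half) by exact: measurableI.
have lB : A `&` left_half `<=` B by apply: subset_trans AB; exact: subIsetl.
have rB : A `&` right_half `<=` B by apply: subset_trans AB; exact: subIsetl.
by rewrite EFinD !EFinB -!E0// -Em// -Ep.
Qed.

Definition lf_leak (mu0 mum mup : lfsbm R d.+1) : lfsbm R d.+1 :=
  Lfsbm (@lf_leak_charge mu0 mum mup).
End lfsbm_leak.

HB.instance Definition _ (R : realType) n := gen_eqMixin (lfsbm R n).
HB.instance Definition _ (R : realType) n := gen_choiceMixin (lfsbm R n).
HB.instance Definition _ (R : realType) n := isPointed.Build (lfsbm R n)
  (lf_zero R n).

Definition test_fun (R : realType) n (phi : 'rV[R]_n -> R) :=
  continuous phi /\ compact (closure [set t | phi t != 0]).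

Section lfsbm_sigma_field.
Variables (R : realType) (n : nat).

(* generators of the sigma-field making every mu |-> \int f dmu measurable *)
Definition lf_int_preimages : set (set (lfsbm R n)) :=
  [set (fun mu => lf_int mu p.1) @^-1` p.2 |
    p in [set p : ('rV[R]_n -> R) * set R | test_fun p.1 /\ measurable p.2]].

HB.instance Definition _ := @isMeasurable.Build (sigma_display lf_int_preimages)
  (lfsbm R n) <<s lf_int_preimages >>
  (@sigma_algebra0 _ setT lf_int_preimages)
  (@sigma_algebraC _ lf_int_preimages)
  (@sigma_algebra_bigcup _ setT lf_int_preimages).

End lfsbm_sigma_field.

Section laws.
Context (R : realType).

(* The fields compared below may be functions of a random field (reindexed,
   rescaled, leak of a split), hence plain functions O -> T in these
   definitions. *)
Definition same_law d (T : measurableType d)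
    d1 (O1 : measurableType d1) (P1 : probability O1 R) (X1 : O1 -> T)
    d2 (O2 : measurableType d2) (P2 : probability O2 R) (X2 : O2 -> T) :=
  forall A : set T, measurable A -> P1 (X1 @^-1` A) = P2 (X2 @^-1` A).

Definition independent2 d (T : measurableType d)
    d1 (O : measurableType d1) (P : probability O R) (X Y : O -> T) :=
  forall A B : set T, measurable A -> measurable B ->
    P (X @^-1` A `&` Y @^-1` B) = (P (X @^-1` A) * P (Y @^-1` B))%E.

Definition cvg_in_law_at_pinfty d1 (O : measurableType d1)
    (P : probability O R) (Z : R -> O -> R) (nu : probability (measurableTypeR R) R) :=
  forall g : R -> R, continuous g -> (exists M, forall x, `|g x| <= M) ->
    ('E_P[g \o Z r] @[r --> +oo%R] --> \int[nu]_x (g x)%:E)%E.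

End laws.

Section random_fields.
Variables (R : realType) (d : nat).
Local Notation field := (lfsbm R d.+1).

Definition stationary d1 (O : measurableType d1) (P : probability O R)
    (X : O -> field) :=
  forall s : 'rV[R]_d.+1, same_law P (fun w => lf_reindex 1%g s (X w)) P X.

Definition is_split d1 (O : measurableType d1) (P : probability O R)
    (X : O -> field) d2 (O' : measurableType d2) (P' : probability O' R)
    (X0 Xm Xp : {RV P' >-> field}) :=
  [/\ independent2 P' Xm Xp, same_law P' X0 P X,
      same_law P' Xm P X & same_law P' Xp P X].

Definition is_leak d1 (O : measurableType d1) (P : probability O R)
    (X : O -> field) d2 (O' : measurableType d2) (P' : probability O' R)
    (Y : {RV P' >-> field}) :=
  exists d3 (O3 : measurableType d3) (P3 : probability O3 R)
      (X0 Xm Xp : {RV P3 >-> field}),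
    is_split P X X0 Xm Xp /\
    same_law P' Y P3 (fun w => lf_leak (X0 w) (Xm w) (Xp w)).

(* With coordinates numbered from 0, perm_first_to i and a shift by r yield
   (t_1, ..., t_i, t_0 + r, t_(i+1), ...) while perm_to_first i yields
   (t_i, t_0, ..., t_(i-1), t_(i+1), ...). *)
Definition perm_first_to (i : 'I_d.+1) : 'S_d.+1 := lift_perm i ord0 1.
Definition perm_to_first (i : 'I_d.+1) : 'S_d.+1 := lift_perm ord0 i 1.

Lemma shift_perm_first_toE (i : 'I_d.+1) (r : R) (t : 'rV[R]_d.+1) j :
  shift_perm (perm_first_to i) (r *: delta_mx ord0 i) t ord0 j =
  if (j < i)%N then t ord0 (inord j.+1)
  else if j == i then t ord0 ord0 + r else t ord0 j.
Proof.
rewrite !mxE /perm_first_to eqxx /=; case: (unliftP i j) => [k ->|->].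
  rewrite lift_perm_lift perm1 -(inj_eq val_inj)/= /bump.
  have [ik|ki] := leqP i k.
    rewrite add1n ltnNge leqW//= gtn_eqF ?ltnS// mulr0 addr0.
    by congr (t _ _); apply/val_inj; rewrite /= /bump leq0n ik.
  rewrite add0n ki ltn_eqF// mulr0 addr0; congr (t _ _); apply/val_inj.
  by rewrite /= inordK ?ltnS//; case: k {ki}.
by rewrite lift_perm_id ltnn eqxx mulr1.
Qed.

Lemma shift_perm_to_firstE (i : 'I_d.+1) (t : 'rV[R]_d.+1) (j : 'I_d.+1) :
  shift_perm (perm_to_first i) 0 t ord0 j =
  if j == ord0 then t ord0 i
  else if (j <= i)%N then t ord0 (inord j.-1) else t ord0 j.
Proof.
rewrite !mxE /perm_to_first addr0; case: (unliftP ord0 j) => [k ->|->].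
  rewrite lift_perm_lift perm1 -(inj_eq val_inj)/= /bump leq0n add1n /=.
  case: ltnP => ik; congr (t _ _); apply/val_inj => /=.
    by rewrite /bump leqNgt ik add0n inordK// (ltn_trans ik).
  by rewrite /bump ik leq0n.
by rewrite lift_perm_id eqxx.
Qed.

(* ([0,1)^k + s) * R^(d.+1 - k), for k <= d.+1 *)
Definition strip k (s : 'rV[R]_k) : set 'rV[R]_d.+1 :=
  [set t | forall (i : 'I_d.+1) (j : 'I_k), i = j :> nat ->
    s ord0 j <= t ord0 i < s ord0 j + 1].

Definition exp_moment_le2 d1 (O : measurableType d1) (P : probability O R)
    (X : O -> field) (A : set 'rV[R]_d.+1) :=
  (\int[P]_w expeR (lf_var (X w) A) <= 2%:E)%E.

(* (1,k)-splittability for 1 <= k <= d.+1. The case k = 0 is not a notion of its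
   own: it is the condition required of Y in the last step (k = 1) of the
   recursion, so that both alternatives of that step read splittable1 k.-1. *)
Fixpoint splittable1 (k : nat) : forall d1 (O : measurableType d1)
    (P : probability O R), (O -> field) -> Prop :=
  match k with
  | 0%N => fun _ _ P X => exp_moment_le2 P X setT
  | k'.+1 => fun _ _ P X =>
    [/\ (forall s : 'rV[R]_k'.+1, exp_moment_le2 P X (strip s)),
        (forall A, bounded_borel A -> ('E_P[fun w => X w A] = 0)%E) &
        (forall (i : 'I_d.+1) (r : R), (i < k'.+1)%N ->
          exists d2 (O' : measurableType d2) (P' : probability O' R)
              (Y : {RV P' >-> field}),
            is_leak P (fun w => lf_reindex (perm_first_to i)
                                  (r *: delta_mx ord0 i) (X w)) Y /\
            splittable1 k' P'
              (fun w => lf_reindex (perm_to_first (inord k')) 0 (Y w)))]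
  end.

Definition Csplittable (C : R) (k : nat) d1 (O : measurableType d1)
    (P : probability O R) (X : O -> field) :=
  splittable1 k P (fun w => lf_scale C^-1 (X w)).

Definition splittable d1 (O : measurableType d1) (P : probability O R)
    (X : O -> field) :=
  exists2 C : R, 0 < C & Csplittable C d.+1 P X.

Definition l2norm (phi : 'rV[R]_d.+1 -> R) : R :=
  Num.sqrt (\int[lebesgue_rV R d.+1]_t (phi t ^+ 2)).

Definition lf_int_scaled (phi : 'rV[R]_d.+1 -> R) (r : R) (mu : field) : R :=
  lf_int mu (fun t => phi (r^-1 *: t)).

(* The expectation is extended real (possibly +oo), and so is its logarithm
   lne; being within eta of a real number forces both to be finite. *)
Definition is_sigma d1 (O : measurableType d1) (P : probability O R)
    (X : O -> field) (sigma : R) :=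
  0 <= sigma /\
  forall phi, test_fun phi -> forall eta : R, 0 < eta ->
    exists r0 delta : R, [/\ 0 < r0, 0 < delta &
      forall r lambda : R, r0 < r -> 0 < `|lambda| < delta ->
        `|lambda| * ln r ^+ d.+1 < delta ->
        (`| ((r ^+ d.+1 * lambda ^+ 2)^-1)%:E *
              lne 'E_P[fun w => expR (lambda * lf_int_scaled phi r (X w))]
            - (2^-1 * l2norm phi ^+ 2 * sigma ^+ 2)%:E | < eta%:E)%E].

End random_fields.

(* Main.v *)
(** Taking lambda = u r^(-d/2) in the limit theorem defining sigma shows that, for
    every real u, the Laplace transform at u of the rescaled integral converges to
    that of N(0, s^2), s = ||phi|| sigma.  Convergence in law follows by approximating
    test functions by exponential sums sum_j a_j e^(u_j x), with errors small relative
    to a weight e^(c |x|), whose means are controlled by the Laplace transforms: first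
    powers of x (as limits of ((e^(hx) - 1) / h)^n), then sin(x / K) (by Taylor
    expansion), then polynomials in sin(x / K).  A bounded continuous function is, on
    [-K, K], uniformly close to such a bounded polynomial by the Weierstrass theorem,
    and outside [-K, K] the difference is negligible against e^|x| when K is large. *)

Require Import Defs.
From mathcomp Require Import all_boot all_order all_algebra.
From mathcomp Require Import all_classical all_reals all_analysis.
From mathcomp Require Import measurable_realfun ring lra.

Set Implicit Arguments.
Unset Strict Implicit.

Import Order.TTheory GRing.Theory Num.Theory.
Import numFieldNormedType.Exports.
Local Open Scope classical_set_scope.
Local Open Scope ring_scope.

(** * Weierstrass approximation *)

(* The Bernstein polynomial sum_k 'C(n, k) u_k X^k (1 - X)^(n - k), generated by
   Pascal's rule so that its moments are computed without binomial identities. *)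
Fixpoint bernstein (R : comNzRingType) (n : nat) (u : nat -> R) : {poly R} :=
  if n is m.+1 then 'X * bernstein m (u \o S) + (1 - 'X) * bernstein m u
  else (u 0%N)%:P.

Lemma horner_bernsteinS (R : comNzRingType) n (u : nat -> R) x :
  (bernstein n.+1 u).[x] =
  x * (bernstein n (u \o S)).[x] + (1 - x) * (bernstein n u).[x].
Proof. by rewrite /= !hornerE. Qed.

Lemma bernstein_cstB (R : comNzRingType) n (u : nat -> R) c x :
  (bernstein n (fun k => c - u k)).[x] = c - (bernstein n u).[x].
Proof.
elim: n u => [|n IH] u; first by rewrite /= !hornerE.
by rewrite !horner_bernsteinS (IH (u \o S)) (IH u); ring.
Qed.

(** The second moment about [c] of a binomial variable with parameters [n] and [x]. The centre stays
    free because the shift [u \o S] replaces [c] by [c - 1] in the induction. *)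
Lemma bernstein_quadratic (R : comNzRingType) n (a b c x : R) :
  (bernstein n (fun k => a * (k%:R - c) ^+ 2 + b)).[x] =
  a * ((n%:R * x - c) ^+ 2 + n%:R * x * (1 - x)) + b.
Proof.
elim: n c => [|n IH] c; first by rewrite /= !hornerE; ring.
rewrite horner_bernsteinS IH.
rewrite [_ \o S](_ : _ = fun k => a * (k%:R - (c - 1)) ^+ 2 + b); last first.
  by apply/funext => k /=; rewrite -natr1; ring.
by rewrite IH -natr1; ring.
Qed.

Lemma ler_norm_bernstein (R : realDomainType) n (u v : nat -> R) x :
  0 <= x <= 1 -> (forall k, (k <= n)%N -> `|u k| <= v k) ->
  `|(bernstein n u).[x]| <= (bernstein n v).[x].
Proof.
move=> /andP[x0 x1]; elim: n u v => [|n IH] u v uv; first by rewrite /= !hornerE uv.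
rewrite !horner_bernsteinS (le_trans (ler_normD _ _))// !normrM (ger0_norm x0).
rewrite (@ger0_norm _ (1 - x)) ?subr_ge0//.
apply: lerD; rewrite ler_wpM2l ?subr_ge0//; apply: IH => k kn /=.
  exact: uv.
by rewrite uv// leqW.
Qed.

(** Compactness of [0, 1] in its near-covering form, for the filter of [h -> 0+]. *)
Lemma itv01_unif_continuous (R : realType) (f : R -> R) (e : R) :
  continuous f -> 0 < e ->
  exists2 h : R, 0 < h & forall x y : R, 0 <= x <= 1 -> `|x - y| < h -> `|f x - f y| < e.
Proof.
move=> cf e0.
have /compact_near_coveringP /(_ _ (0:R)^'+
    (fun h x => forall y, `|x - y| < h -> `|f x - f y| < e) _) := @segment_compact R 0 1.
case=> [x _|h /= h0 hP].
  have e2 : 0 < e / 2 by rewrite divr_gt0.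
  have /cvgrPdist_lt /(_ _ e2) /nbhs_ballP[r /= r0 rP] := cf x.
  have r2 : 0 < r / 2 by rewrite divr_gt0.
  exists (ball x (r / 2), [set h | h < r / 2]) => /=.
    by split; [exact: nbhsx_ballx|exact: nbhs_right_lt].
  move=> -[z h] /= [xz hr] y zy.
  have xy : ball x r y.
    rewrite (splitr r); apply: ball_triangle xz _; rewrite -ball_normE /=.
    exact: lt_trans zy hr.
  have xz' : ball x r z by apply: le_ball xz; rewrite ler_pdivrMr// ler_peMr ?ler1n// ltW.
  rewrite (_ : f z - f y = (f x - f y) - (f x - f z)); last by ring.
  by rewrite (le_lt_trans (ler_normB _ _))// (splitr e) ltrD// rP.
exists (h / 2) => [|x y x01 xy]; first by rewrite divr_gt0.
apply: (hP (h / 2)) => //=; rewrite ?divr_gt0 ?in_itv//.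
by rewrite sub0r normrN gtr0_norm ?divr_gt0// ltr_pdivrMr// ltr_pMr ?ltr1n.
Qed.

Lemma weierstrass_approximation (R : realType) (f : R -> R) (e : R) :
  continuous f -> 0 < e ->
  exists p : {poly R}, forall x, 0 <= x <= 1 -> `|f x - p.[x]| <= e.
Proof.
move=> cf e0; have e2 : 0 < e / 2 by rewrite divr_gt0.
have [M M0 fM] : exists2 M : R, 0 < M & forall x : R, 0 <= x <= 1 -> `|f x| <= M.
  have [|c c01 fc] := @EVT_max R (fun x => `|f x|) 0 1 ler01.
    by apply: continuous_subspaceT => x; apply: continuous_comp;
      [exact: cf|exact: norm_continuous].
  exists (`|f c| + 1) => [|x x01]; first by rewrite ltr_wpDl.
  by rewrite (le_trans (fc _ _)) ?in_itv// lerDl.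
have [h h0 hP] := itv01_unif_continuous cf e2.
(* With this [A], [A (x - y)^2 >= 2 M] once [|x - y| >= h], so [|f x - f y| <= A (x - y)^2 + e / 2]
   on [0, 1]. At [y = k / n] the Bernstein mean of the square is [x (1 - x) / n], which dictates
   [n]. *)
pose A := 2 * M / h ^+ 2.
have A0 : 0 < A by rewrite divr_gt0 ?exprn_gt0// mulr_gt0.
pose n := (Num.truncn (2 * A / e)).+1.
have n0 : 0 < n%:R :> R by rewrite ltr0n.
have nA : A / n%:R <= e / 2.
  have : 2 * A / e < n%:R by exact: truncnS_gt.
  rewrite ltr_pdivrMr// ler_pdivrMr// => H.
  by rewrite ltW//; lra.
exists (bernstein n (fun k => f (k%:R / n%:R))) => x /andP[x0 x1].
have x01 : 0 <= x <= 1 by rewrite x0 x1.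
rewrite -bernstein_cstB.
apply: (le_trans (@ler_norm_bernstein _ n _
  (fun k => A / n%:R ^+ 2 * (k%:R - n%:R * x) ^+ 2 + e / 2) _ x01 _)) => [k kn|].
  have [xk|xk] := ltP `|x - k%:R / n%:R| h.
    rewrite (le_trans (ltW (hP _ _ x01 xk)))// lerDr mulr_ge0 ?sqr_ge0//.
    by rewrite divr_ge0 ?sqr_ge0// ltW.
  have kn01 : 0 <= (k%:R / n%:R : R) <= 1.
    by rewrite divr_ge0//= ler_pdivrMr// mul1r ler_nat.
  have -> : A / n%:R ^+ 2 * (k%:R - n%:R * x) ^+ 2 =
            2 * M * (`|x - k%:R / n%:R| ^+ 2 / h ^+ 2).
    rewrite real_normK ?num_real// /A; field.
    by rewrite !gt_eqF.
  apply: (@le_trans _ _ (2 * M)).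
    by rewrite (le_trans (ler_normB _ _))// (mulr_natl M) mulr2n lerD ?fM.
  rewrite -[leLHS]addr0 lerD//; last exact: ltW.
  rewrite ler_peMr ?mulr_ge0 ?(ltW M0)// ler_pdivlMr ?exprn_gt0// mul1r.
  by rewrite lerXn2r ?nnegrE// (ltW h0).
rewrite bernstein_quadratic subrr expr0n/= add0r [leRHS]splitr lerD2r.
apply: le_trans nA.
have -> : A / n%:R ^+ 2 * (n%:R * x * (1 - x)) = A / n%:R * (x * (1 - x)).
  by field; rewrite gt_eqF.
rewrite ler_piMr ?(divr_ge0 (ltW A0)) ?(ltW n0)//.
by nra.
Qed.

(** * Weighted approximation by exponential sums *)

(** An inductive predicate, so that stability under products and convergence of means follow by
    structural induction. *)
Inductive expsum (R : realType) : (R -> R) -> Prop :=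
| expsum_expR a u : expsum (fun x => a * expR (u * x))
| expsumD f g : expsum f -> expsum g -> expsum (fun x => f x + g x).

Lemma expsumM (R : realType) (f g : R -> R) :
  expsum f -> expsum g -> expsum (fun x => f x * g x).
Proof.
move=> sf sg; elim: sf => [a u|f1 f2 _ IH1 _ IH2].
  elim: sg => [b v|g1 g2 _ IH1 _ IH2].
    rewrite [X in expsum X](_ : _ = fun x => (a * b) * expR ((u + v) * x)).
      exact: expsum_expR.
    by apply/funext => x; rewrite mulrDl expRD; ring.
  by under eq_fun do rewrite mulrDr; exact: expsumD.
by under eq_fun do rewrite mulrDl; exact: expsumD.
Qed.

Section expapprox.
Variable R : realType.
Implicit Types (f g h : R -> R) (a b c e u x : R).

(* Members of this class may be multiplied at the price of adding the exponents c.
   Polynomials belong to it for every c > 0, so that a limit of polynomials of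
   increasing degree can be taken at a fixed c. *)
Definition expapprox c f :=
  (exists C, forall x, `|f x| <= C * expR (c * `|x|)) /\
  forall e, 0 < e -> exists2 p, expsum p &
    forall x, `|f x - p x| <= e * expR (c * `|x|).

Lemma expapprox_expR a u c : `|u| <= c -> expapprox c (fun x => a * expR (u * x)).
Proof.
move=> uc; split=> [|e e0].
  exists `|a| => x; rewrite normrM (ger0_norm (expR_ge0 _)) ler_wpM2l// ler_expR.
  by rewrite (le_trans (ler_norm _))// normrM ler_wpM2r.
exists (fun x => a * expR (u * x)) => [|x]; first exact: expsum_expR.
by rewrite subrr normr0 mulr_ge0 ?expR_ge0 ?ltW.
Qed.

Lemma expapprox_cst a c : 0 <= c -> expapprox c (fun=> a).
Proof.
move=> c0; have : expapprox c (fun x => a * expR (0 * x)).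
  by apply: expapprox_expR; rewrite normr0.
by under eq_fun do rewrite mul0r expR0 mulr1.
Qed.

Lemma expapproxW b c f : b <= c -> expapprox b f -> expapprox c f.
Proof.
move=> bc.
have W x : expR (b * `|x|) <= expR (c * `|x|) by rewrite ler_expR ler_wpM2r.
move=> [[C fC] fapp]; split=> [|e e0].
  exists `|C| => x; apply: le_trans (fC x) _.
  by rewrite (le_trans (ler_wpM2r (expR_ge0 _) (ler_norm C)))// ler_wpM2l.
have [p sp fp] := fapp e e0; exists p => // x.
by rewrite (le_trans (fp x))// ler_wpM2l// ltW.
Qed.

Lemma expapproxD c f g :
  expapprox c f -> expapprox c g -> expapprox c (fun x => f x + g x).
Proof.
move=> [[C fC] fapp] [[D gD] gapp]; split=> [|e e0].
  exists (C + D) => x; rewrite (le_trans (ler_normD _ _))// mulrDl.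
  by apply: lerD.
have e2 : 0 < e / 2 by rewrite divr_gt0.
have [p sp fp] := fapp _ e2; have [q sq gq] := gapp _ e2.
exists (fun x => p x + q x) => [|x]; first exact: expsumD.
rewrite opprD addrACA (le_trans (ler_normD _ _))// (splitr e) mulrDl.
by apply: lerD.
Qed.

Lemma expapproxM b c f g :
  expapprox b f -> expapprox c g -> expapprox (b + c) (fun x => f x * g x).
Proof.
have W x : expR ((b + c) * `|x|) = expR (b * `|x|) * expR (c * `|x|).
  by rewrite mulrDl expRD.
move=> [[C fC] fapp] [[D gD] gapp]; split=> [|e e0].
  exists (C * D) => x; rewrite W mulrACA normrM.
  by apply: ler_pM => //; exact: le_trans (fC x).
(* The error will be at most [d K] times the product of the weights; [d <= 1] keeps [q] below
   [|D| + 1] times its weight. *)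
pose K := `|C| + `|D| + 1.
have K1 : 1 <= K by rewrite lerDr addr_ge0.
have K0 : 0 < K by exact: lt_le_trans K1.
pose d := Num.min 1 (e / K).
have d0 : 0 < d by rewrite lt_min ltr01 divr_gt0.
have d1 : d <= 1 by rewrite ge_min lexx.
have dK : d * K <= e by rewrite -ler_pdivlMr// ge_min lexx orbT.
have [p sp fp] := fapp d d0; have [q sq gq] := gapp d d0.
exists (fun x => p x * q x) => [|x]; first exact: expsumM.
rewrite W; move: (fC x) (gD x) (fp x) (gq x).
set wb := expR (b * _); set wc := expR (c * _) => fx gx fpx gqx.
have wb0 : 0 <= wb by exact: expR_ge0.
have wc0 : 0 <= wc by exact: expR_ge0.
have -> : f x * g x - p x * q x =
    f x * (g x - q x) + (f x - p x) * (g x - (g x - q x)) by ring.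
rewrite (le_trans (ler_normD _ _))// !normrM.
have fx' : `|f x| <= `|C| * wb.
  by rewrite (le_trans fx)// ler_wpM2r// ler_norm.
have gx' : `|g x - (g x - q x)| <= (`|D| + 1) * wc.
  rewrite (le_trans (ler_normB _ _))// mulrDl lerD//.
    by rewrite (le_trans gx)// ler_wpM2r// ler_norm.
  by rewrite (le_trans gqx)// ler_wpM2r.
apply: (@le_trans _ _ (`|C| * wb * (d * wc) + d * wb * ((`|D| + 1) * wc))).
  by apply: lerD; apply: ler_pM.
have -> : `|C| * wb * (d * wc) + d * wb * ((`|D| + 1) * wc) =
  d * K * (wb * wc) by rewrite /K; ring.
by rewrite ler_wpM2r// mulr_ge0.
Qed.

Lemma expapprox_lim c f :
  (forall e, 0 < e -> exists2 h, expapprox c h &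
     forall x, `|f x - h x| <= e * expR (c * `|x|)) ->
  expapprox c f.
Proof.
move=> flim; split=> [|e e0].
  have [h [[C hC] _] fh] := flim 1 ltr01; exists (1 + C) => x.
  by rewrite -[f x](subrK (h x)) (le_trans (ler_normD _ _))// mulrDl lerD.
have e2 : 0 < e / 2 by rewrite divr_gt0.
have [h [_ happ] fh] := flim _ e2; have [p sp hp] := happ _ e2.
exists p => // x; rewrite -[f x](subrK (h x)) -addrA (le_trans (ler_normD _ _))//.
by rewrite (splitr e) mulrDl lerD.
Qed.

(** The inequality [1 + y <= e^y] at [y = x] and [y = -x] gives [0 <= e^x - 1 - x <= x (e^x - 1)];
    the sign of [x] then decides which of the two bounds [e^x - 1]. *)
Lemma expR_taylor1 x : `|expR x - 1 - x| <= x ^+ 2 * expR `|x|.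
Proof.
have E1 : expR x - 1 <= x * expR x.
  have := expR_ge1Dx (- x); rewrite expRN => H.
  have := ler_wpM2l (expR_ge0 x) H; rewrite divff ?gt_eqF ?expR_gt0//.
  by lra.
have E0 := expR_ge1Dx x.
rewrite ger0_norm; last by lra.
have [x0|x0] := leP 0 x; first by rewrite (ger0_norm x0); nra.
have : 1 <= expR `|x| by rewrite -[leLHS]expR0 ler_expR.
by nra.
Qed.

(* Approximation by (e^{hx} - 1) / h, h -> 0. *)
Lemma expapprox_id c : 0 < c -> expapprox c (fun x => x).
Proof.
move=> c0; split=> [|e e0].
  exists c^-1 => x; rewrite mulrC ler_pdivlMr// mulrC.
  by rewrite (le_trans _ (expR_ge1Dx _))// lerDr.
(* Squaring [c / 4 |x| <= e^(c/4 |x|)] gives [x^2 <= K e^(c/2 |x|)]; the other half of the exponent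
   absorbs [e^(h |x|)], as [h <= c / 2]. *)
pose K := (4 / c) ^+ 2.
have K0 : 0 < K by rewrite exprn_gt0// divr_gt0.
pose h := Num.min (c / 2) (e / K).
have h0 : 0 < h by rewrite lt_min !divr_gt0.
have hc : h <= c / 2 by rewrite ge_min lexx.
have hK : h * K <= e by rewrite -ler_pdivlMr// ge_min lexx orbT.
exists (fun x => h^-1 * expR (h * x) + - h^-1 * expR (0 * x)) => [|x].
  exact: expsumD (expsum_expR _ _) (expsum_expR _ _).
rewrite mul0r expR0 mulr1.
have -> : x - (h^-1 * expR (h * x) - h^-1) = - (h^-1 * (expR (h * x) - 1 - h * x)).
  by field; rewrite gt_eqF.
rewrite normrN normrM gtr0_norm ?invr_gt0// mulrC ler_pdivrMr//.
rewrite (le_trans (expR_taylor1 _))// normrM (gtr0_norm h0).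
have x2 : x ^+ 2 <= K * expR (c / 2 * `|x|).
  rewrite (_ : c / 2 * `|x| = 2%:R * (c / 4 * `|x|)); last by field.
  rewrite expRM_natl /K -exprMn -(real_normK (num_real x)) lerXn2r ?nnegrE//.
    by rewrite mulr_ge0 ?expR_ge0// divr_ge0// ltW.
  rewrite -ler_pdivrMl ?divr_gt0// invf_div.
  by rewrite (le_trans _ (expR_ge1Dx _))// lerDr.
have hx : expR (h * `|x|) <= expR (c / 2 * `|x|) by rewrite ler_expR ler_wpM2r.
have -> : e * expR (c * `|x|) * h =
    h * (e * (expR (c / 2 * `|x|) * expR (c / 2 * `|x|))).
  by rewrite -expRD -mulrDl -splitr; ring.
have -> : (h * x) ^+ 2 * expR (h * `|x|) = h * (h * (x ^+ 2 * expR (h * `|x|))).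
  by ring.
rewrite ler_wpM2l ?(ltW h0)//.
apply: (@le_trans _ _ (h * K * (expR (c / 2 * `|x|) * expR (c / 2 * `|x|)))).
  rewrite -(mulrA h K) ler_wpM2l ?(ltW h0)// (mulrA K).
  by apply: ler_pM => //; rewrite ?sqr_ge0 ?expR_ge0.
by rewrite ler_wpM2r// mulr_ge0 ?expR_ge0.
Qed.

(** Induction for all [c] at once: each further degree spends half of the exponent on the new factor
    [x] and leaves half to the induction hypothesis. *)
Lemma expapprox_horner (p : {poly R}) c : 0 < c -> expapprox c (fun x => p.[x]).
Proof.
elim/poly_ind: p c => [|p a IH] c c0.
  by under eq_fun do rewrite horner0; apply: expapprox_cst; exact: ltW.
under eq_fun do rewrite !hornerE.
apply: expapproxD; last by apply: expapprox_cst; exact: ltW.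
by rewrite (splitr c); apply: expapproxM; [apply: IH|apply: expapprox_id]; rewrite divr_gt0.
Qed.

(** Terms of index [k >= N] satisfy [|x|^k <= 2^-N (2 |x|)^k], so the tail is at most [2^-N] times
    the series of [e^(2 |x|)]. The exponent 2 does not depend on [N]. *)
Lemma sin_taylor N x :
  `|sin x - \sum_(0 <= k < N) sin_coeff x k| <= 2 ^- N * expR (2 * `|x|).
Proof.
set a := \sum_(_ <= _ < _) _.
have cv : `|series (sin_coeff x) n - a| @[n --> \oo] --> `|sin x - a|.
  apply: cvg_norm; apply: cvgB; last exact: cvg_cst.
  by rewrite unlock; exact: is_cvg_series_sin_coeff.
rewrite -(cvg_lim _ cv)//; apply: limr_le; first by apply/cvg_ex; eexists; exact: cv.
exists N => // n /= Nn.
rewrite /series /a /= (@big_cat_nat _ _ _ N)//= addrC addrK.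
rewrite (le_trans (ler_norm_sum _ _ _))//.
apply: (@le_trans _ _ (2 ^- N * \sum_(0 <= k < n) exp_coeff (2 * `|x|) k)).
  rewrite [X in _ <= _ * X](@big_cat_nat _ _ _ N)//= mulrDr ler_wpDl//.
    by rewrite mulr_ge0// sumr_ge0// => i _; rewrite divr_ge0// exprn_ge0// mulr_ge0.
  rewrite mulr_sumr; apply: ler_sum_nat => k /andP[Nk _].
  rewrite /sin_coeff /exp_coeff /= normrM normrM normrM normrX normrN normr1 expr1n.
  rewrite mulr1 normrX normfV !normr_nat mulrA ler_wpM2r//.
  rewrite exprMn mulrA; apply: ler_pM => //; rewrite ?exprn_ge0//.
  rewrite mulrC ler_pdivlMr ?exprn_gt0//.
  apply: (@le_trans _ _ (2 ^+ N)); first by case: odd; rewrite ?mul1r ?mul0r ?exprn_ge0.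
  by rewrite ler_weXn2l// ler1n.
rewrite ler_wpM2l ?invr_ge0 ?exprn_ge0//.
apply: nondecreasing_cvgn_le; last exact: is_cvg_series_exp_coeff.
apply: nondecreasing_series => k _ _.
by rewrite exp_coeff_ge0// mulr_ge0.
Qed.

Lemma expapprox_sin c : 0 < c -> expapprox (2 * c) (fun x => sin (c * x)).
Proof.
move=> c0; apply: expapprox_lim => e e0.
(* Indeed [1 / e < N < 2^N]. *)
pose N := (Num.truncn e^-1).+1.
have Ne : 2 ^- N <= e.
  rewrite -[leRHS]invrK lef_pV2 ?posrE ?invr_gt0 ?exprn_gt0//.
  apply/ltW/(lt_le_trans (truncnS_gt _)); rewrite -natrX ler_nat ltnW//.
  exact: ltn_expl.
exists (fun x => \sum_(0 <= k < N) sin_coeff (c * x) k) => [|x].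
  pose p := \poly_(k < N) (c ^+ k * ((odd k)%:R * (-1) ^+ k.-1./2 / k`!%:R)).
  rewrite [X in expapprox _ X](_ : _ = fun x => p.[x]).
    by apply: expapprox_horner; rewrite mulr_gt0.
  apply/funext => x; rewrite horner_poly big_mkord; apply: eq_bigr => k _.
  by rewrite /sin_coeff /= exprMn; ring.
rewrite (le_trans (sin_taylor _ _))// normrM (gtr0_norm c0) mulrA.
by rewrite ler_wpM2r// expR_ge0.
Qed.

Lemma expapprox_horner_comp c f (p : {poly R}) :
  0 < c -> expapprox c f -> exists b, expapprox b (fun x => p.[f x]).
Proof.
move=> c0 fc; elim/poly_ind: p => [|p a [b pb]].
  by exists c; under eq_fun do rewrite horner0; apply: expapprox_cst; exact: ltW.
(* The exponent grows with the degree, harmlessly since [p] is fixed; the maximum with 0 admits the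
   constant term. *)
exists (Num.max 0 (b + c)); under eq_fun do rewrite !hornerE.
apply: expapproxD; last by apply: expapprox_cst; rewrite le_max lexx.
by apply: (@expapproxW (b + c)); [rewrite le_max lexx orbT|exact: expapproxM].
Qed.

End expapprox.

(** * Convergence of means *)

(** Strictness comes from [cos 1 > 0]; it keeps the clamped argument of [asin] inside the open
    interval where [asin] is continuous. *)
Lemma sin1_lt1 (R : realType) : sin 1 < 1 :> R.
Proof.
have := cos2Dsin2 (1 : R); have := cos1_gt0 R; have := sin_le1 (1 : R).
by rewrite !expr2; nra.
Qed.

(* On [-1, 1] the sine is inverted by asin, whose argument is clamped to
   [-sin 1, sin 1], away from the points +/- 1 where asin is not continuous. *)
Lemma factor_through_sin (R : realType) (g : R -> R) (K : R) :
  continuous g -> 0 < K ->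
  exists G : R -> R, [/\ continuous G, forall y, exists x, G y = g x &
    forall x, `|x| <= K -> g x = G ((1 + sin (K^-1 * x)) / 2)].
Proof.
move=> cg K0; pose s : R := sin 1.
have s0 : 0 <= s.
  rewrite ltW// sin_gt0_pi// ltr01/=.
  by rewrite (lt_le_trans _ (pi_ge2 R))// ltr1n.
have s1 : s < 1 by exact: sin1_lt1.
(* The clamp to [[-s, s]], written with absolute values so that its continuity is immediate. *)
pose t z : R := (`|z + s| - `|z - s|) / 2.
have tE z : `|z| <= s -> t z = z.
  rewrite ler_norml => /andP[? ?]; rewrite /t ger0_norm; last by lra.
  by rewrite ler0_norm; [field|lra].
have t1 z : -1 < t z < 1.
  have : `| `|z + s| - `|z - s| | <= `|s + s|.
    by rewrite (_ : s + s = (z + s) - (z - s)) ?ler_dist_dist//; ring.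
  rewrite (ger0_norm (addr_ge0 s0 s0)) ler_norml /t => /andP[? ?].
  by apply/andP; split; lra.
have ct : continuous t.
  move=> z; apply: cvgM; last exact: cvg_cst.
  by apply: cvgB; apply: cvg_norm; [apply: cvgD|apply: cvgB];
    [exact: cvg_id|exact: cvg_cst|exact: cvg_id|exact: cvg_cst].
exists (fun y => g (K * asin (t (2 * y - 1)))); split=> [y|y|x xK]; [|by eexists|].
  have c1 : {for y, continuous (fun z : R => 2 * z - 1)}.
    by apply: cvgB; [apply: cvgM; [exact: cvg_cst|exact: cvg_id]|exact: cvg_cst].
  have c2 := continuous_comp c1 (ct _).
  have c3 := continuous_comp c2 (continuous_asin (t1 _)).
  have c4 : {for y, continuous (fun z : R => K * asin (t (2 * z - 1)))}.
    by apply: cvgM; [exact: cvg_cst|exact: c3].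
  exact: continuous_comp c4 (cg _).
have : `|K^-1 * x| <= 1.
  by rewrite normrM gtr0_norm ?invr_gt0// mulrC ler_pdivrMr// mul1r.
rewrite ler_norml => /andP[x1 x2].
(* Hence [-1, 1] lies in the interval where sine is increasing and [asin] inverts it. *)
have p1 := pihalf_ge1 R.
have sinle (a b : R) : - 1 <= a -> b <= 1 -> a <= b -> sin a <= sin b.
  move=> a1 b1 ab; rewrite leNgt ltr_sin ?in_itv/= -?leNgt//.
    by apply/andP; split; lra.
  by apply/andP; split; lra.
have -> : 2 * ((1 + sin (K^-1 * x)) / 2) - 1 = sin (K^-1 * x) by field.
rewrite tE; last first.
  by rewrite ler_norml -sinN !sinle// lexx.
rewrite sinK; last by rewrite in_itv/=; apply/andP; split; lra.
by rewrite mulrA divff ?mul1r// gt_eqF.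
Qed.

Section method_of_moment_generating_functions.
Context (R : realType) d (T : measurableType d) (P : probability T R).
Context (I : Type) (F : set_system I) {FF : ProperFilter F}.
Variables (Z : I -> T -> R) (nu : probability (measurableTypeR R) R).
Hypothesis mZ : \forall i \near F, measurable_fun setT (Z i).

(** The means are real-valued integrals, for which an infinite value would silently become 0;
    integrability is therefore part of the notion, under [P] only eventually along [F]. *)
Definition cvg_mean (f : R -> R) :=
  [/\ \forall i \near F, P.-integrable setT (EFin \o (f \o Z i)),
      nu.-integrable setT (EFin \o f) &
      (\int[P]_w f (Z i w)) @[i --> F] --> \int[nu]_x f x].

Lemma cvg_meanZ a f : cvg_mean f -> cvg_mean (fun x => a * f x).
Proof.
move=> [Pf nuf cf]; split.
- by apply: filterS Pf => i; exact: integrableZl.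
- exact: integrableZl nuf.
- rewrite RintegralZl//; apply: cvg_trans; last exact: (cvgM (cvg_cst a) cf).
  apply: near_eq_cvg; apply: filterS Pf => i Pfi.
  by rewrite [RHS]RintegralZl.
Qed.

Lemma cvg_meanD f g : cvg_mean f -> cvg_mean g -> cvg_mean (fun x => f x + g x).
Proof.
move=> [Pf nuf cf] [Pg nug cg]; split.
- by apply: filterS2 Pf Pg => i; exact: integrableD.
- exact: integrableD nuf nug.
- rewrite RintegralD//; apply: cvg_trans; last exact: (cvgD cf cg).
  apply: near_eq_cvg; apply: filterS2 Pf Pg => i Pfi Pgi.
  by rewrite [RHS]RintegralD.
Qed.

Hypothesis cvg_mgf : forall u, cvg_mean (fun x => expR (u * x)).

Lemma cvg_mean_expsum f : expsum f -> cvg_mean f.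
Proof.
by elim=> [a u|g h _ ? _ ?]; [exact: cvg_meanZ|exact: cvg_meanD].
Qed.

Lemma dominated_Rintegral d' (T' : measurableType d') (mu : probability T' R)
    (f h W : T' -> R) e : measurable_fun setT f ->
  mu.-integrable setT (EFin \o h) -> mu.-integrable setT (EFin \o W) ->
  (forall x, `|f x - h x| <= e * W x) ->
  mu.-integrable setT (EFin \o f) /\
  `|\int[mu]_x f x - \int[mu]_x h x| <= e * \int[mu]_x W x.
Proof.
move=> mf ih iW fh.
have ieW : mu.-integrable setT (EFin \o (fun x => e * W x)) by exact: integrableZl iW.
have ifh : mu.-integrable setT (EFin \o (fun x => f x - h x)).
  apply: le_integrable ieW => //=.
    apply/measurable_EFinP/measurable_funB => //.
    exact/measurable_EFinP/(measurable_int mu).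
  by move=> x _; rewrite lee_fin (le_trans (fh x))// ler_norm.
have i_f : mu.-integrable setT (EFin \o f).
  rewrite (_ : EFin \o f = EFin \o (fun x => (f x - h x) + h x)).
    exact: integrableD ifh ih.
  by apply/funext => x /=; rewrite subrK.
split=> //; rewrite -RintegralB// -RintegralZl//.
rewrite (le_trans (le_normr_Rintegral _ ifh))//.
apply: le_Rintegral => //.
exact: integrable_norm ifh.
Qed.

(** The weight is dominated by [W x = e^(c x) + e^(-c x)], whose means converge and are thus
    eventually bounded, so the approximation error is uniform along [F] and a three-epsilon argument
    applies. *)
Lemma cvg_mean_lim (c : R) (f : R -> R) : measurable_fun setT f ->
  (forall e, 0 < e -> exists2 h, cvg_mean h &
     forall x, `|f x - h x| <= e * expR (c * `|x|)) ->
  cvg_mean f.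
Proof.
move=> mf flim; pose W x := expR (c * x) + expR (- c * x).
have cW : cvg_mean W by apply: cvg_meanD.
have W0 x : 0 <= W x by rewrite addr_ge0 ?expR_ge0.
have absW x : expR (c * `|x|) <= W x.
  have [x0|x0] := leP 0 x; first by rewrite ger0_norm// /W lerDl expR_ge0.
  by rewrite ltr0_norm// /W mulrN -mulNr lerDr expR_ge0.
have {}flim e : 0 < e -> exists2 h, cvg_mean h & forall x, `|f x - h x| <= e * W x.
  move=> e0; have [h ch fh] := flim _ e0; exists h => // x.
  by rewrite (le_trans (fh x))// ler_wpM2l// ltW.
have [PW nuW cvW] := cW.
have mf' : measurable_fun (setT : set (measurableTypeR R)) f by exact: mf.
have nuf : nu.-integrable setT (EFin \o f).
  have [h [_ nuh _] fh] := flim 1 ltr01.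
  by have [] := dominated_Rintegral mf' nuh nuW fh.
have Pf : \forall i \near F, P.-integrable setT (EFin \o (f \o Z i)).
  have [h [Ph _ _] fh] := flim 1 ltr01.
  apply: filterS3 mZ Ph PW => i mZi Phi PWi.
  have mfZ : measurable_fun setT (f \o Z i) by exact: measurableT_comp.
  by have [] := dominated_Rintegral mfZ Phi PWi (fun w => fh (Z i w)).
split=> //; apply/cvgrPdist_lt => e e0.
set w := \int[nu]_x W x.
have w0 : 0 <= w by apply: Rintegral_ge0.
(* [d' (w + 1) = e / 3] bounds the error under [nu] and, once the mean of [W] is below [w + 1],
   under [P]. *)
pose d' := e / (3 * (w + 1)).
have D0 : 0 < 3 * (w + 1) by rewrite mulr_gt0// ltr_wpDl.
have d0 : 0 < d' by rewrite divr_gt0.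
have dw : d' * (w + 1) = e / 3 by rewrite /d'; field; rewrite !gt_eqF// ltr_wpDl.
have [h [Ph nuh cvh] fh] := flim _ d0.
have [_ nufh] := dominated_Rintegral mf' nuh nuW fh.
have e3 : 0 < e / 3 by rewrite divr_gt0.
have Wlt : \forall i \near F, \int[P]_t W (Z i t) < w + 1.
  by apply: (cvgr_lt w) => //; rewrite ltrDl.
have hlt : \forall i \near F, `|\int[nu]_x h x - \int[P]_t h (Z i t)| < e / 3.
  by move/cvgrPdist_lt : cvh; exact.
near=> i.
have mZi : measurable_fun setT (Z i) by near: i.
have Phi : P.-integrable setT (EFin \o (h \o Z i)) by near: i.
have PWi : P.-integrable setT (EFin \o (W \o Z i)) by near: i.
have mfZ : measurable_fun setT (f \o Z i) by exact: measurableT_comp.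
have [_ Pfh] := dominated_Rintegral mfZ Phi PWi (fun t => fh (Z i t)).
have Wi : \int[P]_t W (Z i t) < w + 1 by near: i.
have hi : `|\int[nu]_x h x - \int[P]_t h (Z i t)| < e / 3 by near: i.
set a := \int[nu]_x f x in nufh *; set a' := \int[P]_x f _ in Pfh *.
set b := \int[nu]_x h x in nufh hi *; set b' := \int[P]_x h _ in Pfh hi *.
have -> : a - a' = (a - b) + (b - b') - (a' - b') by ring.
have ab : `|a - b| < e / 3.
  by rewrite (le_lt_trans nufh)// -dw ltr_pM2l// ltrDl.
have ab' : `|a' - b'| < e / 3.
  by rewrite (le_lt_trans Pfh)// -dw ltr_pM2l.
rewrite (le_lt_trans (ler_normB _ _))// (_ : e = e / 3 + e / 3 + e / 3); last by field.
by rewrite ltrD// (le_lt_trans (ler_normD _ _))// ltrD.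
Unshelve. all: by end_near. Qed.

Lemma cvg_mean_expapprox c (f : R -> R) :
  measurable_fun setT f -> expapprox c f -> cvg_mean f.
Proof.
move=> mf [_ fapp]; apply: (@cvg_mean_lim c) => // e e0.
by have [p sp fp] := fapp e e0; exists p => //; exact: cvg_mean_expsum.
Qed.

Lemma cvg_mean_bounded_continuous (g : R -> R) :
  continuous g -> (exists M, forall x, `|g x| <= M) -> cvg_mean g.
Proof.
move=> cg [M gM].
have M0 : 0 <= M by exact: le_trans (gM 0).
apply: (@cvg_mean_lim 1) => [|e e0]; first exact: continuous_measurable_fun.
(* Outside [[-K, K]] the error is at most [|g| + |G| + |G - p| <= M + M + e], which must not exceed
   [e] times [e^K]. *)
pose K := 1 + (M + M + e) / e.
have K0 : 0 < K.
  by rewrite ltr_pwDl// divr_ge0 ?(ltW e0)// !addr_ge0// ltW.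
have Ke : M + M + e <= e * expR K.
  rewrite mulrC -ler_pdivrMr// (le_trans _ (expR_ge1Dx _))// /K addrA lerDr.
  by rewrite addr_ge0.
have [G [cG Gg gG]] := factor_through_sin cg K0.
have [p Gp] := weierstrass_approximation cG e0.
pose y x := (1 + sin (K^-1 * x)) / 2.
have y01 x : 0 <= y x <= 1.
  have := sin_le1 (K^-1 * x); have := sin_geN1 (K^-1 * x); rewrite /y.
  by move=> ? ?; apply/andP; split; lra.
have Ki : 0 < K^-1 by rewrite invr_gt0.
have K2 : 0 < 2 * K^-1 by rewrite mulr_gt0.
have cy : continuous y.
  move=> x; apply: cvgM; last exact: cvg_cst.
  apply: cvgD; first exact: cvg_cst.
  apply: (@continuous_comp _ _ _ (fun x => K^-1 * x)); last exact: continuous_sin.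
  by apply: cvgM; [exact: cvg_cst|exact: cvg_id].
have /(expapprox_horner_comp p K2)[b pb] : expapprox (2 * K^-1) y.
  rewrite [X in expapprox _ X](_ : _ = fun x => 2^-1 * sin (K^-1 * x) + 2^-1).
    rewrite -[X in expapprox X _]add0r; apply: expapproxD.
      by apply: expapproxM; [exact: expapprox_cst|exact: expapprox_sin].
    by rewrite add0r; apply: expapprox_cst; exact: ltW.
  by apply/funext => x; rewrite /y; field.
exists (fun x => p.[y x]).
  apply: (@cvg_mean_expapprox b) => //.
  apply: continuous_measurable_fun => x.
  by apply: (@continuous_comp _ _ _ y); [exact: cy|exact: continuous_horner].
move=> x; rewrite mul1r.
have px : `|G (y x) - p.[y x]| <= e by apply: Gp; exact: y01.
have [xK|xK] := leP `|x| K.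
  rewrite gG//; apply: (le_trans (Gp _ (y01 x))).
  rewrite ler_peMr ?(ltW e0)// -[leLHS]expR0 ler_expR//.
apply: (@le_trans _ _ (M + M + e)).
  rewrite -[p.[y x]](subKr (G (y x))) (le_trans (ler_normB _ _))// -addrA lerD//.
  by rewrite (le_trans (ler_normB _ _))// lerD//; have [z ->] := Gg (y x).
by rewrite (le_trans Ke)// ler_wpM2l ?(ltW e0)// ler_expR ltW.
Qed.

End method_of_moment_generating_functions.

(** * Gaussian Laplace transform and measurability *)

Section normal_mgf.
Context (R : realType).
Local Notation mu := (@lebesgue_measure R).

(** The Radon-Nikodym derivative and [normal_pdf] have the same integral over every measurable set,
    hence agree almost everywhere. *)
Lemma ge0_integral_normal_prob (m s : R) (f : R -> \bar R) :
  (forall x, 0 <= f x)%E -> measurable_fun setT f ->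
  (\int[normal_prob m s]_x f x = \int[mu]_x (f x * (normal_pdf m s x)%:E))%E.
Proof.
move=> f0 mf.
have dom : normal_prob m s `<< mu by exact: normal_prob_dominates.
rewrite -(Radon_Nikodym_SigmaFinite.change_of_variables dom)//.
have ig := Radon_Nikodym_SigmaFinite.f_integrable dom.
have mpdf : measurable_fun setT (EFin \o normal_pdf m s).
  by apply/measurable_EFinP; exact: measurable_normal_pdf.
apply: ae_eq_integral => //.
- by apply: emeasurable_funM => //; exact: measurable_int ig.
- exact: emeasurable_funM.
- apply: ae_eqe_mul2l; apply: integral_ae_eq => //.
  by move=> A _ mA; rewrite -(Radon_Nikodym_SigmaFinite.f_integral dom).
Qed.

(* Completing the square turns the tilted density of N(0, s^2) into a multiple of
   the density of N(u s^2, s^2). *)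
Lemma integral_expR_normal_prob (s u : R) : s != 0 ->
  (\int[normal_prob 0%R s]_x (expR (u * x))%:E =
   (expR (u ^+ 2 * s ^+ 2 / 2))%:E)%E.
Proof.
move=> s0; rewrite ge0_integral_normal_prob; last 2 first.
- by move=> x; rewrite lee_fin expR_ge0.
- by apply/measurable_EFinP; apply: measurableT_comp => //; exact: measurable_funM.
transitivity (\int[mu]_x
    ((expR (u ^+ 2 * s ^+ 2 / 2))%:E * (normal_pdf (u * s ^+ 2) s x)%:E))%E.
  apply: eq_integral => x _; rewrite -!EFinM !normal_pdfE// /normal_fun; congr EFin.
  rewrite mulrCA [RHS]mulrCA -!expRD; congr (_ * expR _).
  by field.
rewrite ge0_integralZl//=; first by rewrite integral_normal_pdf mule1.
  by apply/measurable_EFinP; exact: measurable_normal_pdf.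
by move=> x _; rewrite lee_fin normal_pdf_ge0.
Qed.

End normal_mgf.

Section random_field_integrals.
Context (R : realType) (n : nat).

Lemma measurable_lf_int d1 (O : measurableType d1) (X : O -> lfsbm R n)
    (f : 'rV[R]_n -> R) :
  measurable_fun setT X -> test_fun f ->
  measurable_fun setT (fun w => lf_int (X w) f).
Proof.
move=> mX tf; have m_int : measurable_fun setT (fun mu : lfsbm R n => lf_int mu f).
  move=> _ B mB; rewrite setTI; apply: sub_sigma_algebra.
  by exists (f, B).
exact: measurableT_comp m_int mX.
Qed.

Lemma test_fun_scale (f : 'rV[R]_n -> R) (r : R) :
  r != 0 -> test_fun f -> test_fun (fun t => f (r^-1 *: t)).
Proof.
move=> r0 [cf kf].
have cZ (a : R) : continuous (fun t : 'rV[R]_n => a *: t).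
  by move=> t; exact: scaler_continuous.
split; first by move=> t; apply: (continuous_comp (cZ _ t) (cf _)).
have kr : compact ((fun t : 'rV[R]_n => r *: t) @` closure [set t | f t != 0]).
  by apply: continuous_compact kf; exact/continuous_subspaceT/cZ.
apply: (subclosed_compact _ kr); first exact: closed_closure.
rewrite closureE; apply: smallest_sub; first exact: compact_closed kr.
move=> t /= ft; exists (r^-1 *: t).
  by apply: subset_closure.
by rewrite scalerA divff// scale1r.
Qed.

End random_field_integrals.

(** * Convergence in law *)

Section normal_limit.
Context (R : realType) d (T : measurableType d) (P : probability T R).
Context (I : Type) (F : set_system I) {FF : ProperFilter F}.
Variable Z : I -> T -> R.
Hypothesis mZ : \forall i \near F, measurable_fun setT (Z i).

Lemma cvg_mean_expectation (nu : probability (measurableTypeR R) R) (g : R -> R) :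
  cvg_mean P F Z nu g ->
  ('E_P[g \o Z i] @[i --> F] --> \int[nu]_x (g x)%:E)%E.
Proof.
move=> [Pg nug cg]; rewrite -(fineK (integrable_fin_num measurableT nug)).
apply/fine_cvgP; rewrite unlock; split=> //.
by apply: filterS Pg => i; exact: integrable_fin_num.
Qed.

Lemma normal_cvg_in_law (s : R) : s != 0 ->
  (forall u, ('E_P[fun w => expR (u * Z i w)] @[i --> F] -->
    (expR (u ^+ 2 * s ^+ 2 / 2))%:E)%E) ->
  forall g : R -> R, continuous g -> (exists M, forall x, `|g x| <= M) ->
  ('E_P[g \o Z i] @[i --> F] --> \int[normal_prob 0%R s]_x (g x)%:E)%E.
Proof.
move=> s0 cmgf g cg bg; apply: cvg_mean_expectation.
apply: cvg_mean_bounded_continuous => // u.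
have mexp : measurable_fun setT (fun x : R => expR (u * x)).
  by apply: measurableT_comp => //; exact: measurable_funM.
(* Convergence to a finite limit makes the Laplace transform eventually finite, which is
   integrability of the positive function [e^(u Z)]. *)
have /fine_cvgP[fin_mgf cf] := cmgf u.
have normalE := integral_expR_normal_prob u s0.
split.
- apply: filterS2 mZ fin_mgf => i mZi; rewrite unlock => fini.
  apply/integrableP; split.
    by apply/measurable_EFinP; exact: measurableT_comp.
  under eq_integral do rewrite /= ger0_norm ?expR_ge0//.
  by rewrite -ge0_fin_numE// integral_ge0// => w _; rewrite lee_fin expR_ge0.
- apply/integrableP; split; first exact/measurable_EFinP.
  under eq_integral do rewrite /= ger0_norm ?expR_ge0//.
  by rewrite normalE ltry.
- rewrite /Rintegral normalE /=.
  by move: cf; rewrite unlock.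
Qed.

End normal_limit.

(** * Laplace transforms in the regime [lambda = u r^(-d/2)] *)

(** With [a = r^(1/4)], the power is [a^(-2D)] and [ln r = 4 ln a <= 4 a]: one factor [a^-D] absorbs
    the logarithms, the other is at most [1 / a]. *)
Lemma powR_half_ln_bound (R : realType) (D : nat) (r : R) : (0 < D)%N -> 1 <= r ->
  r `^ (- (D%:R / 2)) <= (r `^ 4^-1)^-1 /\
  r `^ (- (D%:R / 2)) * ln r ^+ D <= 4 ^+ D / r `^ 4^-1.
Proof.
move=> D0 r1; set a := r `^ 4^-1.
have r0 : 0 <= r by exact: le_trans r1.
have a1 : 1 <= a.
  have -> : 1 = 1 `^ 4^-1 :> R by rewrite powR1.
  by rewrite ge0_ler_powR ?nnegrE ?invr_ge0.
have a0 : 0 < a by exact: lt_le_trans a1.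
have E : r `^ (- (D%:R / 2)) = (a ^+ (D + D))^-1.
  rewrite powRN -powR_mulrn ?powR_ge0// -powRrM natrD; congr (_ `^ _)^-1.
  by field.
rewrite {}E exprD invfM; set t := (a ^+ D)^-1.
have aD : a <= a ^+ D by rewrite ler_eXnr.
have t0 : 0 < t by rewrite invr_gt0 exprn_gt0.
have ta : t <= a^-1 by rewrite lef_pV2 ?posrE ?exprn_gt0.
have t1 : t <= 1 by rewrite (le_trans ta)// invf_le1.
split; first by nra.
have lna : ln r <= 4 * a.
  have -> : ln r = 4 * ln a by rewrite ln_powR mulrA divff ?mul1r.
  by rewrite ler_wpM2l// ltW// ln_sublinear.
have lnD : ln r ^+ D <= (4 * a) ^+ D.
  by rewrite lerXn2r ?nnegrE ?ln_ge0// mulr_ge0 ?ltW.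
apply: (@le_trans _ _ (t * t * (4 * a) ^+ D)).
  by rewrite ler_wpM2l// mulr_ge0// ltW.
rewrite exprMn mulrCA -mulrA mulVf ?gt_eqF ?exprn_gt0// mulr1.
by rewrite ler_wpM2l// exprn_ge0.
Qed.

Lemma is_sigma_cvg_mgf (R : realType) (d : nat)
    (d1 : measure_display) (Omega : measurableType d1)
    (P : probability Omega R) (X : Omega -> lfsbm R d.+1)
    (phi : 'rV[R]_d.+1 -> R) (sigma u : R) :
  test_fun phi -> is_sigma P X sigma ->
  ('E_P[fun w => expR (u * (r `^ (- (d.+1%:R / 2)) * lf_int_scaled phi r (X w)))]
    @[r --> +oo%R] --> (expR (u ^+ 2 * (l2norm phi * sigma) ^+ 2 / 2))%:E)%E.
Proof.
move=> tphi [_ /(_ _ tphi) Xsigma].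
(* The limit defining sigma requires [lambda != 0], so [u = 0] is treated apart. *)
have [->|u0] := eqVneq u 0.
  rewrite expr0n/= !mul0r expR0.
  under eq_fun do under eq_fun do rewrite mul0r expR0.
  rewrite (_ : (fun r : R => 'E_P[fun=> 1%R])%E = cst 1%E); first exact: cvg_cst.
  by apply/funext => r; rewrite expectation_cst.
set L := 2^-1 * l2norm phi ^+ 2 * sigma ^+ 2 in Xsigma.
have -> : u ^+ 2 * (l2norm phi * sigma) ^+ 2 / 2 = u ^+ 2 * L by rewrite /L; ring.
set E := fun r : R => 'E_P[_]%E.
have near_lne eta : 0 < eta -> \forall r \near +oo,
    exists2 l, E r = (expR l)%:E & `|u ^+ 2 * L - l| < eta.
  move=> eta0.
  have u2 : 0 < u ^+ 2 by rewrite exprn_even_gt0.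
  have eta' : 0 < eta / u ^+ 2 by rewrite divr_gt0.
  have [r0 [delta [r00 delta0 Xr]]] := Xsigma _ eta'.
  near=> r.
  have rr0 : r0 < r by near: r; apply: nbhs_pinfty_gt; exact: num_real.
  have r1 : 1 <= r by near: r; apply: nbhs_pinfty_ge; exact: num_real.
  have rp : 0 < r by exact: lt_le_trans r1.
  pose lam := u * r `^ (- (d.+1%:R / 2)).
  have rlam : r ^+ d.+1 * lam ^+ 2 = u ^+ 2.
    rewrite /lam exprMn -(powR_mulrn 2 (powR_ge0 _ _)) -powRrM mulNr divfK//.
    by rewrite powR_invn ?(ltW rp)// mulrCA divff ?mulr1// gt_eqF ?exprn_gt0.
  have a0 : 0 < r `^ 4^-1 by rewrite powR_gt0.
  (* Equivalent to [|u| 4^(d+1) / r^(1/4) < delta], which yields both smallness conditions on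
     [lam]. *)
  have rC : (`|u| * 4 ^+ d.+1 / delta) ^+ 4 < r.
    by near: r; apply: nbhs_pinfty_gt; exact: num_real.
  have C0 : 0 < `|u| * 4 ^+ d.+1 by rewrite mulr_gt0 ?normr_gt0 ?exprn_gt0.
  have ra : `|u| * 4 ^+ d.+1 / delta < r `^ 4^-1.
    rewrite -(@ltr_pXn2r _ 4%N) ?nnegrE ?powR_ge0 ?divr_ge0 ?(ltW C0) ?(ltW delta0)//.
    by rewrite -(powR_mulrn 4 (powR_ge0 _ _)) -powRrM mulVf// powRr1// ltW.
  have [h1 h2] := powR_half_ln_bound (ltn0Sn d) r1.
  have nlam : `|lam| = `|u| * r `^ (- (d.+1%:R / 2)).
    by rewrite normrM (ger0_norm (powR_ge0 _ _)).
  have Ca : `|u| * 4 ^+ d.+1 / r `^ 4^-1 < delta.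
    by rewrite ltr_pdivrMr// [ltRHS]mulrC -ltr_pdivrMr.
  have lam1 : 0 < `|lam| < delta.
    rewrite nlam mulr_gt0 ?normr_gt0 ?powR_gt0//= (le_lt_trans _ Ca)//.
    rewrite -mulrA ler_wpM2l// (le_trans h1)// ler_peMl ?invr_ge0 ?(ltW a0)//.
    by rewrite exprn_ege1// ler1n.
  have lam2 : `|lam| * ln r ^+ d.+1 < delta.
    by rewrite nlam (le_lt_trans _ Ca)// -!mulrA ler_wpM2l.
  have := Xr _ _ rr0 lam1 lam2.
  have -> : ('E_P[fun w => expR (lam * lf_int_scaled phi r (X w))] = E r)%E.
    by congr expectation; apply/funext => w; rewrite /lam mulrA.
  rewrite rlam -/L.
  have E0 : (0 <= E r)%E by apply: expectation_ge0 => w; exact: expR_ge0.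
  rewrite -{2}(lneK (x := E r)); last by rewrite in_itv/= E0 leey.
  (* An infinite logarithm would be at infinite distance from the real limit, so [E r] is the
     exponential of a real [l]. *)
  move: (lne (E r)) => [l|//|//].
    rewrite -EFinM -EFinB/= lte_fin ltr_pdivlMr// => H; exists l => //.
    have -> : u ^+ 2 * L - l = - (((u ^+ 2)^-1 * l - L) * u ^+ 2) by field.
    by rewrite normrN normrM (gtr0_norm u2).
  - by rewrite gt0_muley ?lte_fin ?invr_gt0.
  - by rewrite gt0_muleNy ?lte_fin ?invr_gt0.
apply/fine_cvgP; split.
  by apply: filterS (near_lne _ ltr01) => r [l ->].
pose l r := ln (fine (E r)).
have cl : l r @[r --> +oo] --> u ^+ 2 * L.
  apply/cvgrPdist_lt => eta eta0; apply: filterS (near_lne _ eta0) => r [l' Er H].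
  by rewrite /l Er/= expRK.
apply: cvg_trans; last exact: cvg_comp cl (@continuous_expR R _).
apply: near_eq_cvg; apply: filterS (near_lne _ ltr01) => r [l' Er _].
by rewrite /l /= Er/= expRK.
Unshelve. all: by end_near. Qed.

Theorem corollary1p7 (R : realType) (d : nat)
    (d1 : measure_display) (Omega : measurableType d1)
    (P : probability Omega R) (X : {RV P >-> lfsbm R d.+1})
    (phi : 'rV[R]_d.+1 -> R) (sigma : R) :
  splittable P X -> stationary P X -> test_fun phi -> is_sigma P X sigma ->
  l2norm phi * sigma != 0 ->
  cvg_in_law_at_pinfty P
    (fun r w => r `^ (- (d.+1%:R / 2)) * lf_int_scaled phi r (X w))
    (normal_prob 0 (l2norm phi * sigma)).
Proof.
move=> _ _ tphi Xsigma s0; apply: normal_cvg_in_law => // [|u].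
  (* Rescaling by [r^-1] preserves test functions for [r != 0], hence for all large [r]. *)
  near=> r; apply: measurable_funM => //; apply: measurable_lf_int => //.
  have r0 : 0 < r by near: r; apply: nbhs_pinfty_gt; exact: num_real.
  by apply: test_fun_scale => //; rewrite gt_eqF.
exact: is_sigma_cvg_mgf.
Unshelve. all: by end_near. Qed.
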